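(* Let $n\ge 3$ be an integer, let $h\in C^0[0,\infty)$ satisfy $h(r)\ge-\frac{n-1}{r}$ for all $r>0$, and let $\alpha>0$. Then the solution $u$ of $$u''(r)+\frac{n-1}{r}u'(r)-(n-2)u(r)^3-\frac{2(n-1)}{r}u(r)^2-\frac{n-1}{r^2}u(r)+(n-4)u(r)u'(r)=\left[u'(r)+\frac{u(r)}{r}\right]h(r)$$ with initial conditions $u(0)=0$, $u'(0)=\alpha$ is not global, i.e. it cannot be continued to the whole interval $[0,\infty)$.
   Context: A solution of the initial value problem on an interval $[0,T)$, $0<T\le\infty$, is a function $u\in C^2[0,T)$ satisfying the equation for $r\in(0,T)$ and the initial conditions at $r=0$ (the equation is singular at $r=0$, but for $C^2$ functions with $u(0)=0$ its terms suitably combined have finite limits as $r\to0$). The problem has a local solution, unique as long as it can be continued. A solution is global if it is defined on all of $[0,\infty)$. *)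

(* Defs.v *)
From Stdlib Require Import Reals.
From Coquelicot Require Import Coquelicot.
Open Scope R_scope.

(** The interval [0,T), with 0 < T <= +oo an extended real. *)
Definition Ico0 (T : Rbar) (r : R) : Prop := 0 <= r /\ Rbar_lt r T.

(** Continuity and differentiability relative to a set [D] of reals are the
    standard library's [continue_in] and [D_in]; at the endpoint 0 of [0,T)
    they are the one-sided notions, so values at negative reals are
    irrelevant. *)
Definition C0_on (D : R -> Prop) (f : R -> R) : Prop :=
  forall r, D r -> continue_in f D r.

(** [f] is of class C^2 on [D], with first and second derivatives [f1], [f2]
    there. *)
Definition C2_on (D : R -> Prop) (f f1 f2 : R -> R) : Prop :=
  (forall r, D r -> D_in f f1 D r) /\
  (forall r, D r -> D_in f1 f2 D r) /\
  C0_on D f2.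

Definition ode (n : nat) (h u u1 u2 : R -> R) (r : R) : Prop :=
  u2 r + (INR n - 1) / r * u1 r - (INR n - 2) * u r ^ 3
    - 2 * (INR n - 1) / r * u r ^ 2 - (INR n - 1) / r ^ 2 * u r
    + (INR n - 4) * u r * u1 r
  = (u1 r + u r / r) * h r.

Definition is_solution (n : nat) (h : R -> R) (alpha : R) (T : Rbar)
    (u : R -> R) : Prop :=
  Rbar_lt 0 T /\
  exists u1 u2 : R -> R,
    C2_on (Ico0 T) u u1 u2 /\
    (forall r, 0 < r -> Rbar_lt r T -> ode n h u u1 u2 r) /\
    u 0 = 0 /\ u1 0 = alpha.

(** The solution [u] on [0,T) can be continued to a global one; for
    [T = p_infty] this says that [u] itself is global. *)
Definition continues_globally (n : nat) (h : R -> R) (alpha : R) (T : Rbar)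
    (u : R -> R) : Prop :=
  exists v : R -> R,
    is_solution n h alpha p_infty v /\
    (forall r, Ico0 T r -> v r = u r).

(* Main.v *)
Require Import Defs.
From Stdlib Require Import Reals Lra Lia.
From Coquelicot Require Import Coquelicot.
Open Scope R_scope.

(** The equation hides a Riccati equation.  Put [z = u' - u^2].  When [h] is
    exactly [-(n-1)/r], the equation reads
    [z' = - (2(n-1)/r + (n-2)u) z], so that every solution of [u' = u^2]
    satisfies it.  In general [h >= -(n-1)/r] gives the differential inequality
    [z' >= - (2(n-1)/r + (n-2)u) z] wherever [u' + u/r >= 0]
    ([defect_inequality]).

    Now [z(0) = alpha > 0].  As long as [z > 0], also [u' > u^2 >= 0], hence
    [u > 0] and [u' + u/r > 0], so the inequality is available; by a Gronwall
    argument ([gronwall_positive]) it prevents [z] from reaching zero.  Thus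
    a global solution satisfies [u' > u^2] on the whole half-line
    ([defect_positive]), and [1/u] decreases at least at unit speed, so it
    would become negative in finite time ([riccati_blowup]). *)

(** * Real functions of one variable *)

Lemma nondecreasing_of_derive (f f' : R -> R) (a b : R) :
  a <= b ->
  (forall x, a <= x <= b -> continuity_pt f x) ->
  (forall x, a < x < b -> is_derive f x (f' x)) ->
  (forall x, a < x < b -> 0 <= f' x) ->
  f a <= f b.
Proof.
intros hab hc hd hpos.
(* The mean value theorem may return an endpoint of [[a, b]], where nothing is
   known about [f']; truncating [f'] at 0 keeps its sign there. *)
destruct (MVT_gen f a b (fun x => Rmax 0 (f' x))) as [c [_ hc']].
- intros x hx; rewrite Rmin_left, Rmax_right in hx by lra.
  rewrite Rmax_right by auto; auto.
- intros x hx; rewrite Rmin_left, Rmax_right in hx by lra; auto.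
- assert (0 <= Rmax 0 (f' c) * (b - a)) by
    (apply Rmult_le_pos; [apply Rmax_l | lra]).
  lra.
Qed.

(** The point is the supremum of the [x] such that [f > 0] on [[a, x]]. *)
Lemma first_nonpositive (f : R -> R) (a b : R) :
  (forall x, continuity_pt f x) -> a <= b -> 0 < f a -> f b <= 0 ->
  exists s, a < s <= b /\ f s <= 0 /\ (forall x, a <= x < s -> 0 < f x).
Proof.
intros hc hab ha hb.
set (E := fun x => a <= x <= b /\ forall y, a <= y <= x -> 0 < f y).
assert (hEa : E a).
{ split; [lra|]. intros y hy; replace y with a by lra; exact ha. }
destruct (completeness E) as [s [hub hlub]].
- exists b; intros x [hx _]; lra.
- exists a; exact hEa.
- assert (has : a <= s) by (apply hub; exact hEa).
  assert (hsb : s <= b) by (apply hlub; intros x [hx _]; lra).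
  assert (hbefore : forall x, a <= x < s -> 0 < f x).
  { intros x hx. destruct (Rlt_le_dec 0 (f x)) as [h|h]; [exact h|].
    enough (s <= x) by lra.
    apply hlub; intros y [_ hy].
    destruct (Rle_lt_dec y x) as [h'|h']; [exact h'|].
    specialize (hy x); lra. }
  assert (hs : f s <= 0).
  { destruct (Rle_lt_dec (f s) 0) as [h|h]; [exact h|exfalso].
    destruct (hc s (f s) h) as [d [hd hnear]].
    assert (hpos : forall y, Rabs (y - s) < d -> 0 < f y).
    { intros y hy. destruct (Req_dec s y) as [<-|hne]; [exact h|].
      assert (hfy : Rabs (f y - f s) < f s)
        by (apply hnear; split; [split; [exact I|exact hne]|exact hy]).
      apply Rabs_def2 in hfy; lra. }
    destruct (Rlt_le_dec s b) as [hlt|hge].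
    - pose (t := Rmin b (s + d / 2)).
      assert (ht : s < t) by (apply Rmin_glb_lt; lra).
      assert (htb : t <= b) by apply Rmin_l.
      assert (htd : t <= s + d / 2) by apply Rmin_r.
      enough (E t) by (specialize (hub t H); lra).
      split; [lra|]. intros y hy.
      destruct (Rlt_le_dec y s); [apply hbefore; lra|].
      apply hpos, Rabs_def1; lra.
    - replace b with s in hb by lra; lra. }
  exists s; repeat split; auto.
  destruct has as [has | ->]; lra.
Qed.

(** The inequality says that [exp (K x) * f x] is nondecreasing. *)
Lemma gronwall_positive (f f' : R -> R) (K a b : R) :
  a <= b ->
  (forall x, a <= x <= b -> continuity_pt f x) ->
  (forall x, a < x < b -> is_derive f x (f' x)) ->
  (forall x, a < x < b -> - K * f x <= f' x) ->
  0 < f a -> 0 < f b.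
Proof.
intros hab hc hd hK ha.
assert (hmono : exp (K * a) * f a <= exp (K * b) * f b).
{ apply (nondecreasing_of_derive (fun x => exp (K * x) * f x)
           (fun x => exp (K * x) * (K * f x + f' x))); auto.
  - intros x hx. apply continuity_pt_mult; [|auto].
    apply derivable_continuous_pt, ex_derive_Reals_0.
    auto_derive; exact I.
  - intros x hx. pose proof (hd x hx) as hdx.
    auto_derive.
    + exists (f' x); exact hdx.
    + rewrite (is_derive_unique (fun t : R => f t) _ _ hdx); ring.
  - intros x hx. specialize (hK x hx).
    apply Rmult_le_pos; [left; apply exp_pos | lra]. }
pose proof (exp_pos (K * a)). pose proof (exp_pos (K * b)).
assert (0 < exp (K * a) * f a) by (apply Rmult_lt_0_compat; auto).
nra.
Qed.

(** The derivative of [- 1/u - r] is [u'/u^2 - 1 >= 0], hence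
    [1/u(r) <= 1/u(a) - (r - a)], which vanishes at [r = a + 1/u(a)]. *)
Lemma riccati_blowup (u u' : R -> R) (a : R) :
  (forall x, a <= x -> is_derive u x (u' x)) ->
  (forall x, a <= x -> u x ^ 2 <= u' x) ->
  0 < u a -> False.
Proof.
intros hd hric ha.
assert (hcont : forall x, a <= x -> continuity_pt u x).
{ intros x hx. apply derivable_continuous_pt, ex_derive_Reals_0.
  exists (u' x); auto. }
assert (hpos : forall x, a <= x -> 0 < u x).
{ intros x hx. enough (u a <= u x) by lra.
  apply (nondecreasing_of_derive u u'); auto.
  - intros y hy; apply hcont; lra.
  - intros y hy; apply hd; lra.
  - intros y hy. specialize (hric y). pose proof (pow2_ge_0 (u y)). lra. }
assert (hda : forall x, a <= x ->
  is_derive (fun t => - / u t - t) x (u' x / u x ^ 2 - 1)).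
{ intros x hx. pose proof (hd x hx) as hdx. pose proof (hpos x hx).
  auto_derive.
  - repeat split; [exists (u' x); exact hdx | lra].
  - rewrite (is_derive_unique (fun t : R => u t) _ _ hdx); field; lra. }
pose (b := a + / u a).
assert (hinv : 0 < / u a) by (apply Rinv_0_lt_compat; exact ha).
assert (hmono : - / u a - a <= - / u b - b).
{ apply (nondecreasing_of_derive (fun t => - / u t - t)
           (fun x => u' x / u x ^ 2 - 1)).
  - unfold b; lra.
  - intros x hx. apply derivable_continuous_pt, ex_derive_Reals_0.
    eexists; apply hda; lra.
  - intros x hx; apply hda; lra.
  - intros x hx. assert (hx0 : 0 < u x ^ 2) by (apply pow_lt, hpos; lra).
    enough (1 <= u' x / u x ^ 2) by lra.
    apply (Rle_div_r 1 _ _ hx0). rewrite Rmult_1_l. apply hric; lra. }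
assert (0 < / u b) by (apply Rinv_0_lt_compat, hpos; unfold b; lra).
unfold b in *; lra.
Qed.

(** * From one-sided to two-sided regularity at 0 *)

(** Extending a function on [[0, oo)] by its value at 0 makes it continuous on
    the whole line, so that two-sided calculus applies up to the endpoint. *)
Definition extend0 (f : R -> R) (x : R) : R := f (Rmax 0 x).

Lemma extend0_eq (f : R -> R) (x : R) : 0 <= x -> extend0 f x = f x.
Proof. intros hx; unfold extend0; rewrite Rmax_right; auto. Qed.

Lemma extend0_continuous (f : R -> R) :
  C0_on (Ico0 p_infty) f -> forall x, continuity_pt (extend0 f) x.
Proof.
intros hf x eps heps.
assert (hD : Ico0 p_infty (Rmax 0 x)) by (split; [apply Rmax_l | exact I]).
destruct (hf _ hD eps heps) as [d [hd hnear]].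
exists d; split; [exact hd|].
intros y [_ hy].
change (Rabs (y - x) < d) in hy.
change (Rabs (f (Rmax 0 y) - f (Rmax 0 x)) < eps).
destruct (Req_dec (Rmax 0 x) (Rmax 0 y)) as [heq|hne].
- rewrite heq, Rminus_diag, Rabs_R0; exact heps.
- apply hnear; split.
  + split; [split; [apply Rmax_l | exact I] | exact hne].
  + change (Rabs (Rmax 0 y - Rmax 0 x) < d).
    revert hy; unfold Rmax.
    destruct (Rle_dec 0 y), (Rle_dec 0 x); unfold Rabs;
      repeat destruct Rcase_abs; lra.
Qed.

Lemma extend0_derive (f f' : R -> R) (x : R) :
  0 < x -> D_in f f' (Ico0 p_infty) x -> is_derive (extend0 f) x (f' x).
Proof.
intros hx hf. apply is_derive_Reals. intros eps heps.
destruct (hf eps heps) as [d [hd hnear]].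
assert (hm : 0 < Rmin d x) by (apply Rmin_glb_lt; lra).
exists (mkposreal _ hm); intros t ht0 ht; simpl in ht.
pose proof (Rmin_l d x). pose proof (Rmin_r d x).
assert (htx : - x < t < x) by (apply Rabs_def2 in ht; lra).
rewrite !extend0_eq by lra.
specialize (hnear (x + t)).
change (D_x (Ico0 p_infty) x (x + t) /\ Rabs (x + t - x) < d ->
  Rabs ((f (x + t) - f x) / (x + t - x) - f' x) < eps) in hnear.
replace (x + t - x) with t in hnear by ring.
apply hnear; repeat split; lra.
Qed.

(** * The defect of the Riccati equation *)

(** Replacing [h] by its lower bound in the equation gives
    [u'' >= - 2(n-1)/r u' + (n-2) u^3 + 2(n-1)/r u^2 - (n-4) u u'], whose right
    side minus [2 u u'] factors through [u' - u^2]. *)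
Lemma defect_inequality (n : nat) (h u u1 u2 : R -> R) (r : R) :
  0 < r -> h r >= - ((INR n - 1) / r) -> ode n h u u1 u2 r ->
  0 <= u1 r + u r / r ->
  - (2 * (INR n - 1) / r + (INR n - 2) * u r) * (u1 r - u r ^ 2)
    <= u2 r - 2 * u r * u1 r.
Proof.
unfold ode; intros hr hh hode hpos.
assert (hm : 0 <= (u1 r + u r / r) * (h r + (INR n - 1) / r))
  by (apply Rmult_le_pos; lra).
rewrite Rmult_plus_distr_l, <- hode in hm.
match type of hm with 0 <= ?A =>
  replace (u2 r - 2 * u r * u1 r) with
    (A - (2 * (INR n - 1) / r + (INR n - 2) * u r) * (u1 r - u r ^ 2))
    by (field; lra)
end.
lra.
Qed.

(** At a first zero [s] of the defect the Gronwall lemma is applied on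
    [[s/2, s]], away from the singularity at 0; there [u] is nondecreasing, so
    [2(n-1)/r + (n-2)u] is at most [2(n-1)/(s/2) + (n-2)u(s)]. *)
Lemma defect_positive (n : nat) (h u u1 u2 : R -> R) :
  (2 <= n)%nat ->
  (forall r, 0 < r -> h r >= - ((INR n - 1) / r)) ->
  (forall r, continuity_pt u r) ->
  (forall r, continuity_pt u1 r) ->
  (forall r, 0 < r -> is_derive u r (u1 r)) ->
  (forall r, 0 < r -> is_derive u1 r (u2 r)) ->
  (forall r, 0 < r -> ode n h u u1 u2 r) ->
  u 0 = 0 -> 0 < u1 0 ->
  forall r, 0 <= r -> 0 < u1 r - u r ^ 2.
Proof.
intros hn hh hc hc1 hd hd1 hode h0 h10 r hr.
assert (hN : 2 <= INR n) by (apply (le_INR 2 n) in hn; simpl in hn; lra).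
pose (z := fun x => u1 x - u x ^ 2).
change (0 < z r).
assert (hcz : forall x, continuity_pt z x).
{ intros x. apply continuity_pt_minus; [apply hc1|].
  apply (continuity_pt_ext (fun t => u t * u t)); [intros t; ring|].
  apply continuity_pt_mult; apply hc. }
assert (hdz : forall x, 0 < x -> is_derive z x (u2 x - 2 * u x * u1 x)).
{ intros x hx. pose proof (hd x hx) as hx0. pose proof (hd1 x hx) as hx1.
  unfold z. auto_derive.
  - repeat split; [exists (u2 x); exact hx1 | exists (u1 x); exact hx0].
  - rewrite (is_derive_unique (fun t : R => u t) _ _ hx0).
    rewrite (is_derive_unique (fun t : R => u1 t) _ _ hx1). ring. }
destruct (Rlt_le_dec 0 (z r)) as [hz|hz]; [exact hz|exfalso].
destruct (first_nonpositive z 0 r hcz hr) as [s [[hs _] [hzs hbefore]]];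
  [unfold z; rewrite h0; lra | exact hz |].
assert (hu1 : forall x, 0 <= x < s -> 0 <= u1 x).
{ intros x hx. specialize (hbefore x hx). unfold z in hbefore.
  pose proof (pow2_ge_0 (u x)). lra. }
assert (hmono : forall x y, 0 <= x <= y -> y <= s -> u x <= u y).
{ intros x y hxy hys. apply (nondecreasing_of_derive u u1); auto; try lra.
  - intros t ht; apply hd; lra.
  - intros t ht; apply hu1; lra. }
assert (hupos : forall x, 0 <= x <= s -> 0 <= u x).
{ intros x hx. rewrite <- h0. apply hmono; lra. }
pose (K := 2 * (INR n - 1) / (s / 2) + (INR n - 2) * u s).
enough (0 < z s) by lra.
apply (gronwall_positive z (fun x => u2 x - 2 * u x * u1 x) K (s / 2) s);
  auto; try lra.
- intros x hx; apply hdz; lra.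
- intros x hx.
  assert (hineq := defect_inequality n h u u1 u2 x).
  assert (hzx : 0 < z x) by (apply hbefore; lra).
  assert (hKx : 2 * (INR n - 1) / x + (INR n - 2) * u x <= K).
  { apply Rplus_le_compat.
    - apply Rmult_le_compat_l; [lra|]. apply Rinv_le_contravar; lra.
    - apply Rmult_le_compat_l; [lra|]. apply hmono; lra. }
  assert (0 <= u1 x + u x / x).
  { apply Rplus_le_le_0_compat; [apply hu1; lra|].
    apply Rdiv_le_0_compat; [apply hupos; lra | lra]. }
  apply Rle_trans with
    (- (2 * (INR n - 1) / x + (INR n - 2) * u x) * (u1 x - u x ^ 2)).
  + change (u1 x - u x ^ 2) with (z x). apply Rmult_le_compat_r; lra.
  + apply hineq; auto; [lra | apply hh; lra | apply hode; lra].
- apply hbefore; lra.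
Qed.

Theorem theorem4p1 (n : nat) (hn : (3 <= n)%nat)
    (h : R -> R) (hcont : C0_on (Ico0 p_infty) h)
    (hbound : forall r : R, 0 < r -> h r >= - ((INR n - 1) / r))
    (alpha : R) (halpha : 0 < alpha)
    (T : Rbar) (u : R -> R) (hu : is_solution n h alpha T u) :
  ~ continues_globally n h alpha T u.
Proof.
intros [v [[_ [v1 [v2 [[hv [hv1 _]] [hode [h0 h10]]]]]] _]].
pose (w := extend0 v). pose (w1 := extend0 v1).
assert (hcw : forall x, continuity_pt w x).
{ apply extend0_continuous; intros r hr; apply (cont_deriv _ v1); auto. }
assert (hcw1 : forall x, continuity_pt w1 x).
{ apply extend0_continuous; intros r hr; apply (cont_deriv _ v2); auto. }
assert (hD : forall r, 0 < r -> Ico0 p_infty r)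
  by (intros r hr; split; [lra | exact I]).
assert (hdw : forall r, 0 < r -> is_derive w r (w1 r)).
{ intros r hr. unfold w1; rewrite extend0_eq by lra.
  apply extend0_derive; auto. }
assert (hw0 : w 0 = 0) by (unfold w; rewrite extend0_eq by lra; exact h0).
assert (hz : forall r, 0 <= r -> 0 < w1 r - w r ^ 2).
{ apply (defect_positive n h w w1 v2); auto.
  - lia.
  - intros r hr; apply extend0_derive; auto.
  - intros r hr. unfold ode, w, w1; rewrite !extend0_eq by lra.
    apply hode; [exact hr | exact I].
  - unfold w1; rewrite extend0_eq, h10 by lra; exact halpha. }
(* [w 0 = 0] does not start the blow-up; [w] has become positive by time 1. *)
assert (hmvt : exists c, 0 <= c <= 1 /\ w 1 - w 0 = w1 c * (1 - 0)).
{ destruct (MVT_gen w 0 1 w1) as [c hc].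
  - intros x hx; rewrite Rmin_left, Rmax_right in hx by lra; apply hdw; lra.
  - intros x _; apply hcw.
  - rewrite Rmin_left, Rmax_right in hc by lra; exists c; exact hc. }
destruct hmvt as [c [hc hcw']].
apply (riccati_blowup w w1 1).
- intros x hx; apply hdw; lra.
- intros x hx; specialize (hz x); lra.
- specialize (hz c); pose proof (pow2_ge_0 (w c)); lra.
Qed.
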